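(* Let $A,B\subseteq S\subseteq V$ with $A\cap B=\emptyset$. Then $Y_A$ and $Y_B$ are contemporaneously uncorrelated with respect to $Y_S$ if and only if, for all $b\in B$, $h\in[0,1]$ and $t\in\mathbb{R}$, $$P_{\mathcal{L}_{Y_S}(t)\vee\mathcal{L}_{Y_A}(t,t+1)}Y_b(t+h)=P_{\mathcal{L}_{Y_S}(t)}Y_b(t+h)\quad\mathbb{P}\text{-a.s.}$$
   Context: $V=\{1,\ldots,k\}$ and $Y_V=(Y_V(t))_{t\in\mathbb{R}}$ is a $k$-dimensional weakly stationary stochastic process with expectation zero that is continuous in mean square, with components $Y_v=(Y_v(t))_{t\in\mathbb R}$, $v\in V$, and subprocesses $Y_A=(Y_a)_{a\in A}$ for $A\subseteq V$. $L^2=L^2(\Omega,\mathcal F,\mathbb P)$ is the Hilbert space of square-integrable complex-valued random variables with $\langle X,Y\rangle=\mathbb{E}[X\overline{Y}]$ (a.s. equal variables identified). $P_{\mathcal L}$ is the orthogonal projection onto a closed linear subspace $\mathcal L$, and $\mathcal{L}_1\vee\mathcal{L}_2$ is the closure of $\mathcal{L}_1+\mathcal{L}_2$. For $A\subseteq V$ and $-\infty\le s\le t\le\infty$, $\mathcal{L}_{Y_A}(s,t)$ is the closed linear span in $L^2$ of $\{Y_a(u):a\in A,\ u\in[s,t]\cap\mathbb{R}\}$, and $\mathcal{L}_{Y_A}(t)=\mathcal{L}_{Y_A}(-\infty,t)$ (equal to $\{0\}$ if $A=\emptyset$). Closed subspaces $\mathcal{L}_1,\mathcal{L}_2$ are conditionally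 orthogonal given the closed subspace $\mathcal{L}_3$, written $\mathcal{L}_1\perp\mathcal{L}_2\mid\mathcal{L}_3$, if $\mathbb{E}[(X-P_{\mathcal{L}_3}X)\overline{(Y-P_{\mathcal{L}_3}Y)}]=0$ for all $X\in\mathcal{L}_1$, $Y\in\mathcal{L}_2$. For $A,B\subseteq S\subseteq V$, $A\cap B=\emptyset$, $Y_A$ and $Y_B$ are contemporaneously uncorrelated with respect to $Y_S$ if $\mathcal{L}_{Y_A}(t,t+1)\perp\mathcal{L}_{Y_B}(t,t+1)\mid\mathcal{L}_{Y_S}(t)$ for all $t\in\mathbb{R}$. *)

(* Defs.v *)
From HB Require Import structures.
From mathcomp Require Import all_boot all_order all_algebra.
From mathcomp Require Import complex.
From mathcomp Require Import all_classical all_reals all_analysis.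

Set Implicit Arguments.
Unset Strict Implicit.
Unset Printing Implicit Defensive.

Import Order.TTheory GRing.Theory Num.Theory.
Import numFieldNormedType.Exports.

Local Open Scope classical_set_scope.
Local Open Scope ring_scope.
Local Open Scope complex_scope.

(* The elements of L^2 are represented by functions T -> R[i]. Almost surely
   equal functions are not identified; instead, every subspace considered below
   is closed for the L^2 seminorm within L2, hence contains, with X, every
   complex random variable that is almost surely equal to X. *)
Section ComplexL2.
Context {d : measure_display} {T : measurableType d} {R : realType}.
Variable P : probability T R.
Implicit Types (X Y Z p : T -> R[i]) (L M N G : set (T -> R[i])).

Definition complex_RV X :=
  measurable_fun [set: T] (fun w => complex.Re (X w)) /\
  measurable_fun [set: T] (fun w => complex.Im (X w)).

(* E[|X|^2], possibly +oo *)
Definition sqnorm X : \bar R :=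
  'E_P[fun w => ComplexField.Normc.normc (X w) ^+ 2].

Definition L2 : set (T -> R[i]) :=
  [set X | complex_RV X /\ (sqnorm X < +oo)%E].

Definition cexpectation X : R[i] :=
  fine 'E_P[fun w => complex.Re (X w)] +i* fine 'E_P[fun w => complex.Im (X w)].

Definition inner X Y : R[i] := cexpectation (fun w => X w * (Y w)^*).

Definition ccovariance X Y : R[i] :=
  inner (X - cst (cexpectation X)) (Y - cst (cexpectation Y)).

Definition lin_span G : set (T -> R[i]) :=
  [set X | exists n (a : 'I_n -> R[i]) (g : 'I_n -> T -> R[i]),
     (forall i, G (g i)) /\ X = fun w => \sum_(i < n) a i * g i w].

Definition L2closure G : set (T -> R[i]) :=
  [set X | L2 X /\
     forall e : R, 0 < e -> exists2 Y, G Y & (sqnorm (X - Y)%R < (e ^+ 2)%:E)%E].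

Definition closed_span G := L2closure (lin_span G).

Definition closed_join M N := L2closure [set X + Y | X in M & Y in N].

(* When L is a closed subspace and X is in L2, the Hilbert projection theorem
   says that the element p of L selected here exists and is unique almost
   surely; the default value 0 is then not used. *)
Definition orth_proj L X : T -> R[i] :=
  xget 0 [set p | L p /\ forall Z, L Z -> inner (X - p) Z = 0].

Definition cond_orthogonal M N L :=
  forall X Y, M X -> N Y -> inner (X - orth_proj L X) (Y - orth_proj L Y) = 0.

End ComplexL2.

(* A k-dimensional process is given by its components Y v : R -> T -> R[i],
   for v in V = 'I_k. *)
Section Processes.
Context {d : measure_display} {T : measurableType d} {R : realType}.
Variables (P : probability T R) (k : nat) (Y : 'I_k -> R -> T -> R[i]).
Implicit Types A B S : {set 'I_k}.

Definition weakly_stationary :=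
  [/\ forall v t, L2 P (Y v t),
      forall v t s, cexpectation P (Y v t) = cexpectation P (Y v s)
    & forall v w t s h, ccovariance P (Y v (t + h)) (Y w (s + h)) =
                        ccovariance P (Y v t) (Y w s)].

Definition zero_mean := forall v t, cexpectation P (Y v t) = 0.

Definition mean_square_continuous :=
  forall v t, sqnorm P (Y v u - Y v t) @[u --> t] --> 0%E.

Definition Lspan A (s t : \bar R) : set (T -> R[i]) :=
  closed_span P
    [set X | exists a (u : R), [/\ a \in A, (s <= u%:E <= t)%E & X = Y a u]].

Definition Lpast A (t : R) := Lspan A -oo t%:E.

Definition contemporaneously_uncorrelated A B S :=
  forall t : R,
    cond_orthogonal P (Lspan A t%:E (t + 1)%:E) (Lspan B t%:E (t + 1)%:E)
      (Lpast S t).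

End Processes.

(* Main.v *)
Require Import Defs.
From HB Require Import structures.
From mathcomp Require Import all_boot all_order all_algebra.
From mathcomp Require Import complex ring lra.
From mathcomp Require Import all_classical all_reals all_analysis measurable_realfun.

Set Implicit Arguments.
Unset Strict Implicit.
Unset Printing Implicit Defensive.

Import Order.TTheory GRing.Theory Num.Theory.
Import numFieldNormedType.Exports.

Local Open Scope ring_scope.

(** Write [L] for the closed span of the past of the [S]-components up to time
    [t], [M] and [N] for the closed spans of the [A]- and [B]-components on
    [[t, t + 1]], and [J] for the closed join of [L] and [M]. The theorem is a
    fact about Hilbert space: [M] and [N] are conditionally orthogonal given
    [L] if and only if projecting a generator of [N] on [J] gives the same as
    projecting it on [L] ([cond_orthogonal_closed_span]).

    Let [Z] be a generator of [N] and [p] its projection on [L]. For [X] in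
    [M], with projection [q] on [L], the residual [Z - p] is orthogonal to [q],
    hence [<X, Z - p> = <X - q, Z - p>]. If this vanishes for all [X], then
    [Z - p] is orthogonal to [L + M], hence to [J], and [p], which belongs to
    [J], is the projection of [Z] on [J]. Conversely, if [p] is the projection
    on [J], then [Z - p] is orthogonal to [J], which contains [X - q], and
    [0 = <X - q, Z - p> = <X - q, Z>]. The last equality makes the condition
    linear and continuous in [Z], so that it passes from the generators to
    their closed span.

    This argument uses that the projections exist, in the space of
    square-integrable complex random variables with its seminorm. Existence
    comes from completeness of L^2 ([L2_complete]), which is reduced to real
    and imaginary parts and obtained from almost sure convergence and Fatou's
    lemma ([L2_fast_cauchy_cvg]), followed by the classical minimising sequence
    and parallelogram law ([is_orth_proj_exists]). Projections are only unique
    almost surely, and random variables that vanish almost surely are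
    orthogonal to everything ([inner_ae_eq0]), so that replacing a
    projection by an almost surely equal one preserves all the orthogonality
    relations above. *)

(** * Completeness of real L^2 *)

Section RieszFischer.
Local Open Scope classical_set_scope.
Context {d : measure_display} {T : measurableType d} {R : realType}.
Variable P : probability T R.

(** The first moment is controlled by the second without Cauchy-Schwarz: since
    [P] has mass 1, it suffices to integrate the AM-GM inequality
    [|h| <= e / 2 + h^2 / (2 e)]. *)
Lemma integral_norm_le_of_sqr (h : T -> R) (e : R) :
  0 < e -> measurable_fun [set: T] h ->
  (\int[P]_w (h w ^+ 2)%:E <= (e ^+ 2)%:E)%E ->
  (\int[P]_w `|h w|%:E <= e%:E)%E.
Proof.
move=> e0 mh he.
have mh2 : measurable_fun [set: T] (fun w => (h w ^+ 2)%:E).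
  by apply/measurable_EFinP; exact: measurable_funX.
have e20 : 0 <= e / 2 by rewrite divr_ge0// ltW.
have e21 : 0 <= (2 * e)^-1 by rewrite invr_ge0 mulr_ge0// ltW.
apply: (@le_trans _ _
    (\int[P]_w ((e / 2)%:E + (2 * e)^-1%:E * (h w ^+ 2)%:E))%E).
  apply: ge0_le_integral => //.
  - by apply/measurable_EFinP; exact: measurableT_comp.
  - apply: emeasurable_funD => //; exact: emeasurable_funM.
  - move=> w _; rewrite -EFinM -EFinD lee_fin -(real_normK (num_real (h w))).
    rewrite -subr_ge0.
    have -> : e / 2 + (2 * e)^-1 * `|h w| ^+ 2 - `|h w|
        = (e - `|h w|) ^+ 2 / (2 * e) by field; rewrite gt_eqF.
    by rewrite divr_ge0 ?sqr_ge0// mulr_ge0// ltW.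
rewrite ge0_integralD//; last 2 first.
- by move=> w _; rewrite -EFinM lee_fin mulr_ge0// sqr_ge0.
- exact: emeasurable_funM.
rewrite integral_cst//= probability_setT mule1 ge0_integralZl//; last first.
  by move=> w _; rewrite lee_fin sqr_ge0.
apply: (@le_trans _ _ ((e / 2)%:E + (2 * e)^-1%:E * (e ^+ 2)%:E)%E).
  by rewrite leeD2l// lee_wpmul2l// lee_fin.
rewrite -EFinM -EFinD lee_fin le_eqVlt; apply/orP; left; apply/eqP.
by field; rewrite gt_eqF.
Qed.

(** The expected total variation [\sum_n |f (n + 1) - f n|] of the sequence is
    at most [\sum_n 2^-n = 2], so it is almost surely finite. *)
Lemma summable_steps_ae_cvg (f : nat -> T -> R) :
  (forall n, measurable_fun [set: T] (f n)) ->
  (forall n, \int[P]_w ((f n.+1 w - f n w) ^+ 2)%:E <= ((2^-1 ^+ n) ^+ 2)%:E)%E ->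
  {ae P, forall w, cvgn (f ^~ w)}.
Proof.
move=> mf fstep.
pose D n w : \bar R := `|f n.+1 w - f n w|%:E.
have mD n : measurable_fun [set: T] (D n).
  by apply/measurable_EFinP; apply: measurableT_comp => //; exact: measurable_funB.
have D0 n w : (0 <= D n w)%E by rewrite lee_fin.
have mS : measurable_fun [set: T] (fun w => \sum_(n <oo) D n w)%E.
  by apply: ge0_emeasurable_sum.
have intD n : (\int[P]_w D n w <= (2^-1 ^+ n)%:E)%E.
  apply: integral_norm_le_of_sqr; first by rewrite exprn_gt0.
    exact: measurable_funB.
  exact: fstep.
have intS : (\int[P]_w \sum_(n <oo) D n w < +oo)%E.
  rewrite integral_nneseries//.
  apply: (@le_lt_trans _ _ (\sum_(n <oo) (2^-1 ^+ n)%:E)%E).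
    by apply: lee_nneseries => [n _ _|n _]; [exact: integral_ge0|exact: intD].
  suff: (\sum_(n <oo) (2^-1 ^+ n)%:E <= (2 : R)%:E)%E by move/le_lt_trans; apply; rewrite ltry.
  apply: lime_le; first by apply: is_cvg_nneseries => n _ _; rewrite lee_fin.
  apply: nearW => n; rewrite sumEFin lee_fin.
  suff -> : \sum_(0 <= k < n) (2^-1 ^+ k : R) = 2 - 2 * 2^-1 ^+ n.
    by rewrite gerBl mulr_ge0// exprn_ge0.
  elim: n => [|n IHn]; first by rewrite big_nil expr0 mulr1 subrr.
  by rewrite big_nat_recr//= IHn exprS; field.
have iS : P.-integrable setT (fun w => \sum_(n <oo) D n w)%E.
  apply/integrableP; split => //.
  under eq_integral do rewrite gee0_abs ?nneseries_ge0//.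
  exact: intS.
have := integrable_ae measurableT iS.
apply: filterS => w /(_ I) Sw.
have : cvgn (series (telescope (f ^~ w))).
  apply: normed_cvg; apply: nondecreasing_is_cvgn.
    by apply: nondecreasing_series => n _ _; exact: normr_ge0.
  exists (fine (\sum_(n <oo) D n w)%E) => _ [n _ <-].
  rewrite -lee_fin fineK// /series/= -sumEFin.
  by apply: (@nneseries_lim_ge _ (D ^~ w) xpredT) => k _ _.
rewrite telescopeK => cf.
rewrite (_ : f ^~ w = (fun n => (f n w - f 0 w) + f 0 w)).
  by apply: is_cvgD => //; exact: is_cvg_cst.
by apply/funext => n; rewrite subrK.
Qed.

(** Riesz-Fischer for sequences with a prescribed rate: the sequence converges
    almost surely, and Fatou's lemma transfers the rate to the limit. *)
Lemma L2_fast_cauchy_cvg (f : nat -> T -> R) :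
  (forall n, measurable_fun [set: T] (f n)) ->
  (forall m n, (n <= m)%N ->
     \int[P]_w ((f m w - f n w) ^+ 2)%:E <= ((2^-1 ^+ n) ^+ 2)%:E)%E ->
  exists2 g : T -> R, measurable_fun [set: T] g &
    forall n, (\int[P]_w ((g w - f n w) ^+ 2)%:E <= ((2^-1 ^+ n) ^+ 2)%:E)%E.
Proof.
move=> mf fC.
(* The upper limit is measurable without any convergence assumption, and it is
   the limit almost surely. *)
pose g w := fine (limn_esup (fun n => (f n w)%:E)).
have mg : measurable_fun [set: T] g.
  apply: measurableT_comp; first exact: fine_measurable.
  by apply: measurable_fun_limn_esup => n; exact/measurable_EFinP.
exists g => // n.
have cvgf : {ae P, forall w, f ^~ w @ \oo --> g w}.
  have := summable_steps_ae_cvg mf (fun n => fC n.+1 n (leqnSn n)).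
  apply: filterS => w cf.
  have /cvg_limn_einf_sup[_] : (fun n => (f n w)%:E) @ \oo --> (limn (f ^~ w))%:E.
    by apply: cvg_EFin; [exact: nearW|exact: cf].
  by rewrite /g => -> /=.
(* Fatou is applied to the sequence shifted by n, all of whose integrals satisfy
   the bound. *)
pose F m w : \bar R := ((f (m + n)%N w - f n w) ^+ 2)%:E.
have mF m : measurable_fun [set: T] (F m).
  by apply/measurable_EFinP; apply: measurable_funX; exact: measurable_funB.
have F0 m w : (0 <= F m w)%E by rewrite lee_fin sqr_ge0.
rewrite (@ge0_ae_eq_integral _ _ _ _ _ _ (fun w => limn_einf (F ^~ w)))//; first last.
- apply: filterS cvgf => w cw _; apply/esym.
  apply: (cvg_limn_einf_sup _).1.
  apply: cvg_EFin; first exact: nearW.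
  apply: (@cvg_comp _ _ _ (fun m => f (m + n)%N w) (fun x => (x - f n w) ^+ 2) _ (nbhs (g w))).
    by have := cw; rewrite -(cvg_shiftn n).
  apply: (@continuous_comp _ _ _ (fun x : R => x - f n w) (fun x => x ^+ 2)).
    by apply: cvgB; [exact: cvg_id|exact: cvg_cst].
  exact: exprn_continuous.
- move=> w _; rewrite limn_einf_lim; apply: lime_ge; first exact: is_cvg_einfs.
  by apply: nearW => m; apply: le_ereal_inf_tmp => _ [k _ <-].
- by move=> w _; rewrite lee_fin sqr_ge0.
- apply: measurableT_comp => //.
  apply: (@measurable_fun_limn_esup _ _ _ _ (fun m w => - F m w)%E) => m.
  exact: measurableT_comp.
- by apply/measurable_EFinP; apply: measurable_funX; exact: measurable_funB.
apply: le_trans (fatou _ _ _ _) _ => //.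
rewrite limn_einf_lim; apply: lime_le; first exact: is_cvg_einfs.
apply: nearW => m; apply: le_trans (fC (m + n)%N n (leq_addl _ _)).
by apply: ereal_inf_lbound; exists m => //=.
Qed.

End RieszFischer.

(** * The inner product of complex random variables *)

Section InnerProduct.
Local Open Scope classical_set_scope.
Context {d : measure_display} {T : measurableType d} {R : realType}.
Variable P : probability T R.
Local Open Scope complex_scope.
Implicit Types (X Y Z U : T -> R[i]) (a c : R[i]) (t : R).

Local Notation inner := (inner P).
Local Notation L2 := (L2 P).
Local Notation sqnorm := (sqnorm P).
Local Notation Re := complex.Re.
Local Notation Im := complex.Im.

(** An infinite [sqnorm X] is sent to 0, so [nsq] measures [X] only on [L2]. *)
Definition nsq X : R := fine (sqnorm X).

Let ReD c c' : Re (c + c') = Re c + Re c'.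
Proof. by case: c c' => [? ?] [? ?]. Qed.

Let ImD c c' : Im (c + c') = Im c + Im c'.
Proof. by case: c c' => [? ?] [? ?]. Qed.

Let sqmod c : R := Re c ^+ 2 + Im c ^+ 2.

Let sqmod_ge0 c : 0 <= sqmod c.
Proof. by rewrite addr_ge0// sqr_ge0. Qed.

Lemma sqnormE X : sqnorm X = (\int[P]_w (sqmod (X w))%:E)%E.
Proof.
rewrite /Defs.sqnorm unlock; apply: eq_integral => w _; congr EFin.
by rewrite /sqmod; case: (X w) => x y /=; rewrite sqr_sqrtr// addr_ge0// sqr_ge0.
Qed.

Lemma sqnorm_ge0 X : (0 <= sqnorm X)%E.
Proof. by rewrite sqnormE; apply: integral_ge0 => w _; rewrite lee_fin. Qed.

Lemma nsq_ge0 X : 0 <= nsq X.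
Proof. exact/fine_ge0/sqnorm_ge0. Qed.

Lemma sqnorm_fin X : L2 X -> sqnorm X = (nsq X)%:E.
Proof. by move=> [_ fX]; rewrite fineK// ge0_fin_numE// sqnorm_ge0. Qed.

Let measurable_sqmod X : complex_RV X -> measurable_fun [set: T] (fun w => sqmod (X w)).
Proof. by move=> [mR mI]; apply: measurable_funD; exact: measurable_funX. Qed.

Let measurable_esqmod X : complex_RV X ->
  measurable_fun [set: T] (fun w => (sqmod (X w))%:E).
Proof. by move=> /measurable_sqmod/measurable_EFinP. Qed.

Lemma complex_RVD X Y : complex_RV X -> complex_RV Y -> complex_RV (X + Y).
Proof.
move=> [XR XI] [YR YI]; split.
  rewrite (_ : (fun _ => _) = fun w => Re (X w) + Re (Y w)); first exact: measurable_funD.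
  by apply/funext => w; exact: ReD.
rewrite (_ : (fun _ => _) = fun w => Im (X w) + Im (Y w)); first exact: measurable_funD.
by apply/funext => w; exact: ImD.
Qed.

Lemma complex_RVZ a X : complex_RV X -> complex_RV (cst a \* X).
Proof.
move=> [XR XI]; case: a => a1 a2; split.
  rewrite (_ : (fun _ => _) = fun w => a1 * Re (X w) - a2 * Im (X w)).
    by apply: measurable_funB; apply: measurable_funM.
  by apply/funext => w /=; case: (X w).
rewrite (_ : (fun _ => _) = fun w => a1 * Im (X w) + a2 * Re (X w)).
  by apply: measurable_funD; apply: measurable_funM.
by apply/funext => w /=; case: (X w).
Qed.

Lemma L2D X Y : L2 X -> L2 Y -> L2 (X + Y).
Proof.
move=> [mX fX] [mY fY]; split; first exact: complex_RVD.
have mEX := measurable_esqmod mX; have mEY := measurable_esqmod mY.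
have mEXY := measurable_esqmod (complex_RVD mX mY).
apply: (@le_lt_trans _ _ (2%:E * sqnorm X + 2%:E * sqnorm Y)%E).
  rewrite !sqnormE -!ge0_integralZl//; try by move=> w _; rewrite lee_fin.
  rewrite -ge0_integralD//;
    try by [move=> w _; rewrite -EFinM lee_fin mulr_ge0|exact: measurable_funeM].
  apply: ge0_le_integral => //.
  - by move=> w _; rewrite lee_fin.
  - by apply: emeasurable_funD; apply: measurable_funeM.
  - move=> w _; rewrite -!EFinM -EFinD lee_fin /sqmod.
    rewrite -[(X + Y) w]/(X w + Y w); case: (X w) (Y w) => [x1 x2] [y1 y2] /=.
    rewrite -subr_ge0.
    set rhs := (X in 0 <= X).
    have -> : rhs = (x1 - y1) ^+ 2 + (x2 - y2) ^+ 2 by rewrite /rhs; ring.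
    by rewrite addr_ge0// sqr_ge0.
by rewrite lte_add_pinfty// lte_mul_pinfty// ?lee_fin.
Qed.

Lemma L2Z a X : L2 X -> L2 (cst a \* X).
Proof.
move=> [mX fX]; split; first exact: complex_RVZ.
suff -> : sqnorm (cst a \* X) = ((sqmod a)%:E * sqnorm X)%E.
  by rewrite lte_mul_pinfty// lee_fin.
rewrite !sqnormE -ge0_integralZl//;
  try by [rewrite lee_fin|move=> w _; rewrite lee_fin|exact: measurable_esqmod].
apply: eq_integral => w _; rewrite -EFinM /sqmod/=; congr EFin.
by case: a (X w) => [a1 a2] [x1 x2] /=; ring.
Qed.

Lemma L20 : L2 0.
Proof.
split; first by split; exact: measurable_cst.
rewrite sqnormE (eq_integral (cst 0%E)) ?integral0// => w _.
by rewrite /sqmod/= expr0n/= addr0.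
Qed.

Lemma scaleN1 X : cst (-1) \* X = - X.
Proof. by apply/funext => w; exact: mulN1r. Qed.

Lemma L2N X : L2 X -> L2 (- X).
Proof. by rewrite -scaleN1; exact: L2Z. Qed.

Lemma L2B X Y : L2 X -> L2 Y -> L2 (X - Y).
Proof. by move=> hX hY; exact/L2D/L2N. Qed.

Definition cintegrable X :=
  P.-integrable [set: T] (fun w => (Re (X w))%:E) /\
  P.-integrable [set: T] (fun w => (Im (X w))%:E).

Lemma cexpectationD X Y : cintegrable X -> cintegrable Y ->
  cexpectation P (X + Y) = cexpectation P X + cexpectation P Y.
Proof.
move=> [XR XI] [YR YI]; rewrite /cexpectation.
have -> : (fun w => Re ((X + Y) w)) = (fun w => Re (X w) + Re (Y w)).
  by apply/funext => w; exact: ReD.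
have -> : (fun w => Im ((X + Y) w)) = (fun w => Im (X w) + Im (Y w)).
  by apply/funext => w; exact: ImD.
rewrite !unlock.
rewrite !integralD_EFin//.
by congr (_ +i* _); rewrite fineD ?integrable_fin_num.
Qed.

Lemma cexpectationZ a X : cintegrable X ->
  cexpectation P (cst a \* X) = a * cexpectation P X.
Proof.
move=> [XR XI]; rewrite /cexpectation; case: a => a1 a2.
have -> : (fun w => Re ((cst (a1 +i* a2) \* X) w)) =
    (fun w => a1 * Re (X w) - a2 * Im (X w)).
  by apply/funext => w /=; case: (X w).
have -> : (fun w => Im ((cst (a1 +i* a2) \* X) w)) =
    (fun w => a1 * Im (X w) + a2 * Re (X w)).
  by apply/funext => w /=; case: (X w).
rewrite !unlock.
have iZ b (f : T -> R) : P.-integrable [set: T] (fun w => (f w)%:E) ->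
    P.-integrable [set: T] (fun w => (b * f w)%:E) /\
    (\int[P]_w (b * f w)%:E = b%:E * \int[P]_w (f w)%:E)%E.
  by move=> fi; split; [exact: (integrableZl measurableT b fi)|
    exact: (integralZl measurableT fi b)].
have [/= R1 R1E] := iZ a1 _ XR; have [/= R2 R2E] := iZ a2 _ XR.
have [/= I1 I1E] := iZ a1 _ XI; have [/= I2 I2E] := iZ a2 _ XI.
have fR := integrable_fin_num measurableT XR.
have fI := integrable_fin_num measurableT XI.
rewrite integralB_EFin// integralD_EFin//= R1E R2E I1E I2E.
by congr (_ +i* _); [rewrite fineB ?fin_numM// !fineM|rewrite fineD ?fin_numM// !fineM].
Qed.

Lemma cexpectationJ X : cintegrable X ->
  cexpectation P (fun w => (X w)^*) = (cexpectation P X)^*.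
Proof.
move=> [XR XI]; rewrite /cexpectation.
have -> : (fun w => Re ((X w)^*)) = (fun w => Re (X w)).
  by apply/funext => w; case: (X w).
have -> : (fun w => Im ((X w)^*)) = (fun w => -1 * Im (X w)).
  by apply/funext => w; rewrite mulN1r; case: (X w).
rewrite !unlock.
under [X in _ +i* fine X = _]eq_integral => w _ do rewrite EFinM.
rewrite integralZl// fineM// ?integrable_fin_num//=.
by rewrite mulN1r.
Qed.

(** Both parts of [X * Y^*] are of the form [x1 * y1 + x2 * y2], which is
    dominated by [|X|^2 + |Y|^2]. *)
Lemma cintegrable_mulJ X Y : L2 X -> L2 Y -> cintegrable (fun w => X w * (Y w)^*).
Proof.
move=> hX hY; have mX := hX.1; have mY := hY.1.
have iS Z : L2 Z -> P.-integrable [set: T] (fun w => (sqmod (Z w))%:E).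
  move=> [mZ fZ]; apply/integrableP; split.
    exact: measurable_esqmod.
  by under eq_integral => w _ do rewrite gee0_abs ?lee_fin//; rewrite -sqnormE.
have dom (f : T -> R) : measurable_fun [set: T] f ->
    (forall w, `|f w| <= sqmod (X w) + sqmod (Y w)) ->
    P.-integrable [set: T] (fun w => (f w)%:E).
  move=> mf fle.
  apply: (@le_integrable _ _ _ P _ measurableT _
    ((fun w => (sqmod (X w))%:E) \+ (fun w => (sqmod (Y w))%:E))%E).
  - exact/measurable_EFinP.
  - by move=> w _ /=; rewrite lee_fin (le_trans (fle w))// ler_norm.
  - by apply: integrableD => //; exact: iS.
have bnd (x1 x2 y1 y2 : R) :
    `|x1 * y1 + x2 * y2| <= x1 ^+ 2 + x2 ^+ 2 + (y1 ^+ 2 + y2 ^+ 2).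
  have := (sqr_ge0 (x1 - y1), sqr_ge0 (x2 - y2), sqr_ge0 (x1 + y1), sqr_ge0 (x2 + y2)).
  have := (sqr_ge0 x1, sqr_ge0 x2, sqr_ge0 y1, sqr_ge0 y2).
  rewrite ler_norml => -[[[h1 h2] h3] h4] [[[h5 h6] h7] h8].
  by apply/andP; split; nra.
split; apply: dom.
- rewrite (_ : (fun _ => _) = fun w => Re (X w) * Re (Y w) + Im (X w) * Im (Y w)).
    by apply: measurable_funD; apply: measurable_funM; apply mX || apply mY.
  by apply/funext => w; case: (X w) (Y w) => [? ?] [? ?] /=; ring.
- move=> w; rewrite /sqmod; case: (X w) (Y w) => [x1 x2] [y1 y2] /=.
  by rewrite mulrN opprK; exact: bnd.
- rewrite (_ : (fun _ => _) = fun w => Im (X w) * Re (Y w) - Re (X w) * Im (Y w)).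
    by apply: measurable_funB; apply: measurable_funM; apply mX || apply mY.
  by apply/funext => w; case: (X w) (Y w) => [? ?] [? ?] /=; ring.
- move=> w; rewrite /sqmod; case: (X w) (Y w) => [x1 x2] [y1 y2] /=.
  have := bnd x1 x2 (- y2) y1; rewrite sqrrN; lra.
Qed.

Lemma innerDl X Y Z : L2 X -> L2 Y -> L2 Z -> inner (X + Y) Z = inner X Z + inner Y Z.
Proof.
move=> hX hY hZ; rewrite /Defs.inner -cexpectationD; [|exact: cintegrable_mulJ..].
by congr cexpectation; apply/funext => w /=; rewrite mulrDl.
Qed.

Lemma innerZl a X Z : L2 X -> L2 Z -> inner (cst a \* X) Z = a * inner X Z.
Proof.
move=> hX hZ; rewrite /Defs.inner -cexpectationZ; last exact: cintegrable_mulJ.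
by congr cexpectation; apply/funext => w /=; rewrite mulrA.
Qed.

Lemma innerC X Y : L2 X -> L2 Y -> inner Y X = (inner X Y)^*.
Proof.
move=> hX hY; rewrite /Defs.inner -cexpectationJ; last exact: cintegrable_mulJ.
by congr cexpectation; apply/funext => w; rewrite rmorphM/= conjcK mulrC.
Qed.

Lemma inner_self X : inner X X = (nsq X)%:C.
Proof.
rewrite /Defs.inner /cexpectation /nsq sqnormE !unlock.
rewrite (_ : (\int[P]_w (Im (X w * (X w)^*))%:E)%E = 0%E); last first.
  rewrite (eq_integral (cst 0%E)) ?integral0// => w _.
  by congr EFin; case: (X w) => x y /=; ring.
congr (fine _ +i* _); apply: eq_integral => w _; congr EFin.
by rewrite /sqmod; case: (X w) => x y /=; ring.
Qed.

Lemma innerNl X Z : L2 X -> L2 Z -> inner (- X) Z = - inner X Z.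
Proof. by move=> hX hZ; rewrite -scaleN1 innerZl// mulN1r. Qed.

Lemma innerBl X Y Z : L2 X -> L2 Y -> L2 Z -> inner (X - Y) Z = inner X Z - inner Y Z.
Proof. by move=> hX hY hZ; rewrite innerDl ?innerNl//; exact: L2N. Qed.

Lemma innerDr X Y Z : L2 X -> L2 Y -> L2 Z -> inner Z (X + Y) = inner Z X + inner Z Y.
Proof.
move=> hX hY hZ; rewrite innerC//; last exact: L2D.
by rewrite innerDl// (innerC hX hZ) (innerC hY hZ) rmorphD.
Qed.

Lemma innerZr a X Z : L2 X -> L2 Z -> inner Z (cst a \* X) = a^* * inner Z X.
Proof.
move=> hX hZ; rewrite innerC//; last exact: L2Z.
by rewrite innerZl// (innerC hX hZ) rmorphM.
Qed.

Lemma innerBr X Y Z : L2 X -> L2 Y -> L2 Z -> inner Z (X - Y) = inner Z X - inner Z Y.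
Proof.
move=> hX hY hZ; rewrite innerDr//; last exact: L2N.
by rewrite -scaleN1 innerZr// rmorphN rmorph1/= mulN1r.
Qed.

End InnerProduct.

(** * Geometry and closed subspaces of L^2 *)

Section Geometry.
Local Open Scope classical_set_scope.
Context {d : measure_display} {T : measurableType d} {R : realType}.
Variable P : probability T R.
Local Open Scope complex_scope.
Implicit Types (X Y Z U p q : T -> R[i]) (L G : set (T -> R[i])) (a c : R[i]) (e : R).

Local Notation inner := (inner P).
Local Notation L2 := (L2 P).
Local Notation L2closure := (L2closure P).
Local Notation nsq := (nsq P).
Local Notation normc := ComplexField.Normc.normc.

Lemma normc_sqr c : normc c ^+ 2 = complex.Re c ^+ 2 + complex.Im c ^+ 2.
Proof. by case: c => x y /=; rewrite sqr_sqrtr// addr_ge0// sqr_ge0. Qed.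

Lemma normc_sqrD_le c c' : normc (c + c') ^+ 2 <= 2 * normc c ^+ 2 + 2 * normc c' ^+ 2.
Proof.
rewrite !normc_sqr; case: c c' => [x1 x2] [y1 y2] /=.
rewrite -subr_ge0.
set rhs := (X in 0 <= X).
have -> : rhs = (x1 - y1) ^+ 2 + (x2 - y2) ^+ 2 by rewrite /rhs; ring.
by rewrite addr_ge0// sqr_ge0.
Qed.

Lemma nsqZ a X : L2 X -> nsq (cst a \* X) = normc a ^+ 2 * nsq X.
Proof.
move=> hX; apply: complexI; rewrite -inner_self innerZl//; last exact: L2Z.
rewrite innerZr// inner_self normc_sqr; case: a => a1 a2.
by apply/eqP; rewrite eq_complex /=; apply/andP; split; apply/eqP; ring.
Qed.

Lemma nsqN X : L2 X -> nsq (- X) = nsq X.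
Proof.
by move=> hX; rewrite -scaleN1 nsqZ// normc_sqr/= oppr0 expr0n/= addr0 sqrrN expr1n mul1r.
Qed.

Lemma nsqBC X Y : L2 X -> L2 Y -> nsq (X - Y) = nsq (Y - X).
Proof. by move=> hX hY; rewrite -nsqN ?opprB//; exact: L2B. Qed.

Lemma parallelogram X Y : L2 X -> L2 Y ->
  nsq (X + Y) + nsq (X - Y) = 2 * nsq X + 2 * nsq Y.
Proof.
move=> hX hY; apply: complexI.
have hN := L2N hY; have hD := L2D hX hY; have hB := L2B hX hY.
transitivity ((nsq (X + Y))%:C + (nsq (X - Y))%:C); first exact: rmorphD.
transitivity (2 * (nsq X)%:C + 2 * (nsq Y)%:C); last first.
  by rewrite rmorphD !rmorphM rmorph_nat.
rewrite -!inner_self.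
rewrite innerDl// innerBl// (innerDr hX hY hX) (innerDr hX hY hY) !innerBr//.
by ring.
Qed.

Lemma nsqD_le X Y : L2 X -> L2 Y -> nsq (X + Y) <= 2 * nsq X + 2 * nsq Y.
Proof. by move=> hX hY; rewrite -parallelogram// lerDl nsq_ge0. Qed.

(** The coefficient is aligned with [inner U Z] so that the cross term is real:
    only a quadratic polynomial in the real number [e] remains. *)
Lemma nsqB_scale e U Z : L2 U -> L2 Z ->
  nsq (U - cst (e%:C * inner U Z) \* Z) =
  nsq U - 2 * e * normc (inner U Z) ^+ 2 + e ^+ 2 * normc (inner U Z) ^+ 2 * nsq Z.
Proof.
move=> hU hZ; set a := e%:C * _; have haZ : L2 (cst a \* Z) by exact: L2Z.
apply: complexI; rewrite -inner_self innerBl//; last exact: L2B.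
rewrite !innerBr// !innerZl// !innerZr// !inner_self (innerC hU hZ) normc_sqr /a.
case: (inner U Z) => x y.
by apply/eqP; rewrite eq_complex /=; apply/andP; split; apply/eqP; ring.
Qed.

(** The variational principle behind projections: if subtracting multiples of
    [Z] cannot decrease [nsq U] by more than [e], then [U] is nearly orthogonal
    to [Z]. It is obtained from [nsqB_scale] with the step [(1 + nsq Z)^-1],
    which is close enough to the optimal step [(nsq Z)^-1] and also makes sense
    when [nsq Z] is zero. *)
Lemma almost_orthogonal e U Z : L2 U -> L2 Z ->
  (forall a, nsq U <= nsq (U - cst a \* Z) + e) ->
  normc (inner U Z) ^+ 2 <= e * (1 + nsq Z).
Proof.
move=> hU hZ /(_ ((1 + nsq Z)^-1%:C * inner U Z)); rewrite nsqB_scale//.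
have := nsq_ge0 P Z; have := sqr_ge0 (normc (inner U Z)).
set N := _ ^+ 2; set q := nsq Z => N0 q0.
have s0 : 0 < 1 + q by rewrite ltr_pwDl.
rewrite -addrA -addrA lerDl => h.
have {h} : 0 <= (1 + q) ^+ 2 * (- (2 * (1 + q)^-1 * N)
    + ((1 + q)^-1 ^+ 2 * N * q + e)) by rewrite mulr_ge0// sqr_ge0.
have -> : (1 + q) ^+ 2 * (- (2 * (1 + q)^-1 * N) + ((1 + q)^-1 ^+ 2 * N * q + e))
    = (1 + q) * (e * (1 + q) - N) - N by field; rewrite gt_eqF.
rewrite subr_ge0 => /(le_trans N0).
by rewrite pmulr_rge0// subr_ge0.
Qed.

(** This crude form of the Cauchy-Schwarz inequality, which is
    [almost_orthogonal] with [e = nsq U], gives the continuity of [inner]. *)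
Lemma inner_sqr_le U Z : L2 U -> L2 Z ->
  normc (inner U Z) ^+ 2 <= nsq U * (1 + nsq Z).
Proof. by move=> hU hZ; apply: almost_orthogonal => // a; rewrite lerDr nsq_ge0. Qed.

Lemma sqr_normc_eq0 c (K : R) : 0 <= K ->
  (forall e, 0 < e -> normc c ^+ 2 <= e * K) -> c = 0.
Proof.
move=> K0 h; apply: ComplexField.eq0_normC.
apply/eqP; rewrite -sqrf_eq0 -rmorphXn/= fmorph_eq0 eq_le sqr_ge0 andbT.
rewrite leNgt; apply/negP => N0.
have K2 : 0 < 2 * (K + 1) by rewrite mulr_gt0// ltr_wpDl.
have := h (normc c ^+ 2 / (2 * (K + 1))) (divr_gt0 N0 K2).
rewrite mulrAC ler_pdivlMr// ler_pM2l//; lra.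
Qed.

Lemma nsq_eq0P X : L2 X -> nsq X = 0 <-> X = cst 0 %[ae P].
Proof.
move=> hX; have [mR mI] := hX.1.
pose f w : \bar R := (complex.Re (X w) ^+ 2 + complex.Im (X w) ^+ 2)%:E.
have mf : measurable_fun [set: T] f.
  by apply/measurable_EFinP; apply: measurable_funD; exact: measurable_funX.
have f0 w : f w = 0%E <-> X w = 0.
  rewrite /f; case: (X w) => x y /=; split => [[]|[-> ->]]; last by rewrite expr0n addr0.
  move/eqP; rewrite paddr_eq0 ?sqr_ge0// !sqrf_eq0 => /andP[/eqP -> /eqP ->].
  by [].
have [sqX0 X0sq] := ae_eq_integral_abs P measurableT mf.
have intf : (\int[P]_w `|f w| = (nsq X)%:E)%E.
  rewrite -sqnorm_fin// sqnormE; apply: eq_integral => w _.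
  by rewrite gee0_abs// lee_fin addr_ge0// sqr_ge0.
rewrite {}intf in sqX0 X0sq; split => [X0|aeX0].
  by move: (sqX0 (congr1 EFin X0)); apply: filterS => w /[apply] /f0.
apply/EFin_inj/X0sq; move: aeX0; apply: filterS => w /[apply] X0.
exact/f0.
Qed.

Lemma nsq0 : nsq 0 = 0.
Proof. by apply/(nsq_eq0P (L20 P)); exact: aeW. Qed.

Lemma inner_ae_eq0 U Z : L2 U -> L2 Z -> U = cst 0 %[ae P] -> inner U Z = 0.
Proof.
move=> hU hZ /(nsq_eq0P hU) U0; apply: (@sqr_normc_eq0 _ 0) => // e e0.
by rewrite mulr0; have := inner_sqr_le hU hZ; rewrite U0 mul0r.
Qed.

Definition L2subspace L := [/\ L `<=` L2, L 0,
  forall X Y, L X -> L Y -> L (X + Y) & forall a X, L X -> L (cst a \* X)].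

Lemma L2subspaceB L X Y : L2subspace L -> L X -> L Y -> L (X - Y).
Proof. by move=> [_ _ LD LZ] LX LY; apply: LD => //; rewrite -scaleN1; exact: LZ. Qed.

(** The tolerance [e ^+ 2] of [L2closure] may be replaced by [e], which avoids
    square roots. *)
Lemma L2closureP G X : G `<=` L2 -> L2closure G X <->
  L2 X /\ forall e, 0 < e -> exists2 Y, G Y & nsq (X - Y) < e.
Proof.
move=> GL2; split => -[hX h]; split => // e e0.
  have e1 : 0 < Num.min 1 e by rewrite lt_min ltr01.
  have [Y GY] := h _ e1; rewrite sqnorm_fin ?lte_fin; last by apply: L2B => //; exact: GL2.
  move=> hY; exists Y => //; apply: (lt_le_trans hY).
  apply: (@le_trans _ _ (Num.min 1 e)); last by rewrite ge_min lexx orbT.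
  by rewrite expr2 ger_pMl// ge_min lexx.
have [Y GY hY] := h (e ^+ 2) (exprn_gt0 _ e0).
by exists Y => //; rewrite sqnorm_fin ?lte_fin//; apply: L2B => //; exact: GL2.
Qed.

Lemma sub_L2closure G : G `<=` L2 -> G `<=` L2closure G.
Proof.
move=> GL2 X GX; apply/L2closureP => //; split; first exact: GL2.
move=> e e0; by exists X => //; rewrite subrr nsq0.
Qed.

Lemma L2closure_L2 G : L2closure G `<=` L2.
Proof. by move=> X []. Qed.

Lemma L2closure_closed G : G `<=` L2 -> L2closure (L2closure G) `<=` L2closure G.
Proof.
move=> GL2 X /(L2closureP _ (@L2closure_L2 G))[hX h].
apply/L2closureP => //; split => // e e0.
have e4 : 0 < e / 4 by rewrite divr_gt0.
have [Y clY XY] := h _ e4.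
have [hY /(_ _ e4)[Z GZ YZ]] := (L2closureP Y GL2).1 clY.
exists Z => //; rewrite -(subrK Y X) -addrA.
apply: le_lt_trans (nsqD_le _ _) _; [exact: L2B|apply: L2B => //; exact: GL2|].
lra.
Qed.

Lemma L2closure_subspace L : L2subspace L -> L2subspace (L2closure L).
Proof.
move=> [LL2 L0 LD LZ]; split; first exact: L2closure_L2.
- exact: sub_L2closure.
- move=> X Y /(L2closureP _ LL2)[hX cX] /(L2closureP _ LL2)[hY cY].
  apply/L2closureP => //; split; first exact: L2D.
  move=> e e0; have e4 : 0 < e / 4 by rewrite divr_gt0.
  have [X' LX' XX'] := cX _ e4; have [Y' LY' YY'] := cY _ e4.
  exists (X' + Y'); first exact: LD.
  rewrite opprD addrACA.
  apply: le_lt_trans (nsqD_le _ _) _; do 1?[by apply: L2B => //; exact: LL2].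
  lra.
- move=> a X /(L2closureP _ LL2)[hX cX].
  apply/L2closureP => //; split; first exact: L2Z.
  move=> e e0; have n0 := sqr_ge0 (normc a).
  have n1 : 0 < normc a ^+ 2 + 1 by rewrite ltr_wpDl.
  have [Y LY XY] := cX _ (divr_gt0 e0 n1).
  exists (cst a \* Y); first exact: LZ.
  have -> : cst a \* X - cst a \* Y = cst a \* (X - Y).
    by apply/funext => w; rewrite -[LHS]/(a * X w - a * Y w) -mulrBr.
  have hXY : L2 (X - Y) by apply: L2B => //; exact: LL2.
  rewrite nsqZ//; move: XY; rewrite ltr_pdivlMr// => /(le_lt_trans _); apply.
  by rewrite mulrC ler_wpM2l ?nsq_ge0// lerDl.
Qed.

Lemma lin_span_ind G (Q : set (T -> R[i])) : Q 0 ->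
  (forall a X Y, G X -> Q Y -> Q (cst a \* X + Y)) -> lin_span G `<=` Q.
Proof.
move=> Q0 QD X [n [b [g [Gg ->]]]].
elim: n b g Gg => [|n IHn] b g Gg.
  by rewrite (_ : (fun _ => _) = 0)//; apply/funext => w; rewrite big_ord0.
rewrite (_ : (fun _ => _) = cst (b ord0) \* g ord0 +
    (fun w => \sum_(i < n) b (lift ord0 i) * g (lift ord0 i) w)).
  by apply: QD => //; exact: IHn.
by apply/funext => w; rewrite big_ord_recl.
Qed.

Lemma lin_span_subspace G : G `<=` L2 -> L2subspace (lin_span G).
Proof.
move=> GL2.
have LZ a X : lin_span G X -> lin_span G (cst a \* X).
  move=> [n [b [g [Gg ->]]]]; exists n, (fun i => a * b i), g; split => //.
  by apply/funext => w /=; rewrite mulr_sumr; apply: eq_bigr => i _; rewrite mulrA.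
split => //.
- by apply: lin_span_ind => [|a X Y /GL2 hX hY]; [exact: L20|apply: L2D => //; exact: L2Z].
- exists 0%N, (fun=> 0), (fun=> 0); split; first by case.
  by apply/funext => w; rewrite big_ord0.
- move=> _ _ [m [b [g [Gg ->]]]] [n [b' [g' [Gg' ->]]]].
  exists (m + n)%N, (fun i => match fintype.split i with inl j => b j | inr j => b' j end),
    (fun i => match fintype.split i with inl j => g j | inr j => g' j end).
  split; first by move=> i; case: fintype.split.
  apply/funext => w; rewrite big_split_ord; congr (_ + _); apply: eq_bigr => i _.
    by rewrite (unsplitK (inl i)).
  by rewrite (unsplitK (inr i)).
Qed.

Lemma sub_lin_span G : G `<=` lin_span G.
Proof.
move=> X GX; exists 1%N, (fun=> 1), (fun=> X); split => //.
by apply/funext => w; rewrite big_ord1 mul1r.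
Qed.

Lemma orthogonal_lin_span U G : L2 U -> G `<=` L2 ->
  (forall Z, G Z -> inner U Z = 0) -> forall Z, lin_span G Z -> inner U Z = 0.
Proof.
move=> hU GL2 orth; suff oL2 : lin_span G `<=` [set Z | L2 Z /\ inner U Z = 0].
  by move=> Z /oL2[].
apply: lin_span_ind => [|a X Y GX [hY oY]].
  by split; [exact: L20|rewrite -(subrr (0 : T -> R[i])) innerBr ?subrr//; exact: L20].
have hX := GL2 _ GX; split; first by apply: L2D => //; exact: L2Z.
have hZ := L2Z a hX; rewrite (innerDr hZ hY hU) (innerZr a hX hU) oY orth//.
by rewrite mulr0 addr0.
Qed.

Lemma orthogonal_L2closure U G : L2 U -> G `<=` L2 ->
  (forall Z, G Z -> inner U Z = 0) -> forall Z, L2closure G Z -> inner U Z = 0.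
Proof.
move=> hU GL2 orth Z /(L2closureP _ GL2)[hZ cZ].
apply: (@sqr_normc_eq0 _ (1 + nsq U)); first by rewrite addr_ge0// nsq_ge0.
move=> e e0; have [Y GY ZY] := cZ _ e0; have hY := GL2 _ GY.
have -> : inner U Z = (inner (Z - Y) U)^*.
  by rewrite -innerC//; [rewrite innerBr// (orth _ GY) subr0|exact: L2B].
have -> c : normc (c^*) ^+ 2 = normc c ^+ 2.
  by rewrite !normc_sqr; case: c => x y /=; rewrite sqrrN.
apply: (le_trans (inner_sqr_le (L2B hZ hY) hU)).
by rewrite ler_wpM2r ?addr_ge0 ?nsq_ge0// ltW.
Qed.

End Geometry.

(** * Orthogonal projections *)

Section Projection.
Local Open Scope classical_set_scope.
Context {d : measure_display} {T : measurableType d} {R : realType}.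
Variable P : probability T R.
Local Open Scope complex_scope.
Implicit Types (X Y Z U p q : T -> R[i]) (L M N G : set (T -> R[i])).

Local Notation inner := (inner P).
Local Notation L2 := (L2 P).
Local Notation L2closure := (L2closure P).
Local Notation nsq := (nsq P).
Local Notation normc := ComplexField.Normc.normc.
Local Notation eps n := ((2^-1 ^+ n) ^+ 2 : R).

(** The real and the imaginary parts form fast Cauchy sequences in real L^2;
    the factor 2 comes from adding the two errors. *)
Lemma L2_complete (Z_ : nat -> T -> R[i]) : (forall n, L2 (Z_ n)) ->
  (forall m n, (n <= m)%N -> nsq (Z_ m - Z_ n) <= eps n) ->
  exists2 p, L2 p & forall n, nsq (p - Z_ n) <= 2 * eps n.
Proof.
move=> hZ ZC.
have part (re : R[i] -> R) : (forall x y, re (x - y) = re x - re y) ->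
    (forall c, re c ^+ 2 <= complex.Re c ^+ 2 + complex.Im c ^+ 2) ->
    (forall n, measurable_fun [set: T] (fun w => re (Z_ n w))) ->
    exists2 g : T -> R, measurable_fun [set: T] g &
    forall n, (\int[P]_w ((g w - re (Z_ n w)) ^+ 2)%:E <= (eps n)%:E)%E.
  move=> reB reN mre.
  apply: L2_fast_cauchy_cvg => // m n nm.
  have hB := L2B (hZ m) (hZ n).
  apply: (@le_trans _ _ (sqnorm P (Z_ m - Z_ n))); last first.
    by rewrite sqnorm_fin// lee_fin ZC.
  rewrite sqnormE; apply: ge0_le_integral => //.
  - by move=> w _; rewrite lee_fin sqr_ge0.
  - by apply/measurable_EFinP; apply: measurable_funX; exact: measurable_funB.
  - apply/measurable_EFinP; have [mR mI] := hB.1.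
    by apply: measurable_funD; exact: measurable_funX.
  - by move=> w _; rewrite lee_fin -reB; exact: reN.
have [g1 mg1 g1Z] : exists2 g : T -> R, measurable_fun [set: T] g &
    forall n, (\int[P]_w ((g w - complex.Re (Z_ n w)) ^+ 2)%:E <= (eps n)%:E)%E.
  apply: part => [[? ?] [? ?]//|c|n]; first by rewrite lerDl sqr_ge0.
  by have [[]] := hZ n.
have [g2 mg2 g2Z] : exists2 g : T -> R, measurable_fun [set: T] g &
    forall n, (\int[P]_w ((g w - complex.Im (Z_ n w)) ^+ 2)%:E <= (eps n)%:E)%E.
  apply: part => [[? ?] [? ?]//|c|n]; first by rewrite lerDr sqr_ge0.
  by have [[]] := hZ n.
pose p w := g1 w +i* g2 w.
have mp : complex_RV p by [].
have pZ n : (sqnorm P (p - Z_ n)%R <= (2 * eps n)%:E)%E.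
  rewrite sqnormE.
  have -> : (fun w => (complex.Re ((p - Z_ n) w) ^+ 2 + complex.Im ((p - Z_ n) w) ^+ 2)%:E) =
    (fun w => ((g1 w - complex.Re (Z_ n w)) ^+ 2)%:E + ((g2 w - complex.Im (Z_ n w)) ^+ 2)%:E)%E.
    by apply/funext => w; rewrite -[(p - _) w]/(p w - Z_ n w) /p; case: (Z_ n w).
  have [[mR mI] _] := hZ n.
  rewrite ge0_integralD//.
  - by rewrite mulr_natl mulr2n EFinD; apply: leeD.
  - by move=> w _; rewrite lee_fin sqr_ge0.
  - by apply/measurable_EFinP; apply: measurable_funX; exact: measurable_funB.
  - by move=> w _; rewrite lee_fin sqr_ge0.
  - by apply/measurable_EFinP; apply: measurable_funX; exact: measurable_funB.
have hpZ n : L2 (p - Z_ n).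
  split; last by rewrite (le_lt_trans (pZ n))// ltry.
  have mN : complex_RV (- Z_ n) := (L2N (hZ n)).1.
  exact: complex_RVD.
exists p; first by rewrite -(subrK (Z_ 0%N) p); exact: L2D.
by move=> n; have := pZ n; rewrite sqnorm_fin// lee_fin.
Qed.

Lemma eps_small (e : R) : 0 < e -> exists n, eps n < e.
Proof.
move=> e0; pose N := Num.bound e^-1; have h : e^-1 < 2 ^+ N by exact: upper_nthrootP.
exists N; have p0 : 0 < (2^-1 ^+ N : R) by rewrite exprn_gt0.
apply: (@le_lt_trans _ _ (2^-1 ^+ N)).
  by rewrite expr2 ger_pMl// exprn_ile1// invf_le1 ?ler1n.
by rewrite exprVn invf_plt// ?posrE ?exprn_gt0.
Qed.

Definition is_orth_proj L X p := L p /\ forall Z, L Z -> inner (X - p) Z = 0.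

(** Existence in the Hilbert projection theorem. A minimising sequence for the
    distance from [X] to [L] is Cauchy by the parallelogram law, since midpoints
    of its terms stay in [L]. Its limit is orthogonal because each term is
    orthogonal up to its distance to the minimum ([almost_orthogonal]); in this
    way one need not show that the limit attains the minimum. *)
Lemma is_orth_proj_exists L X : L2subspace P L -> L2closure L `<=` L -> L2 X ->
  exists p, is_orth_proj L X p.
Proof.
move=> sL clL hX; have [LL2 L0 LD LZ] := sL.
pose S := [set nsq (X - Z) | Z in L].
have lbS : has_inf S.
  split; first by exists (nsq (X - 0)), 0.
  by exists 0 => _ [Z _ <-]; exact: nsq_ge0.
pose D := inf S.
have DL Z : L Z -> D <= nsq (X - Z).
  by move=> LZ0; apply: ge_inf; [exact: lbS.2|exists Z].
(* With the slack eps n / 4, the parallelogram law gives exactly the rate eps n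
   that [L2_complete] requires. *)
have near n : {Z | L Z /\ nsq (X - Z) < D + eps n / 4}.
  apply: cid; have e0 : 0 < eps n / 4 by rewrite divr_gt0// !exprn_gt0.
  by have [_ [Z LZ0 <-] h] := inf_adherent e0 lbS; exists Z.
pose z n := sval (near n).
have Lz n : L (z n) := (svalP (near n)).1.
have Dz n : nsq (X - z n) < D + eps n / 4 := (svalP (near n)).2.
have hz n : L2 (z n) by exact: LL2.
have eps_le m n : (n <= m)%N -> eps m <= eps n.
  move=> nm; rewrite lerXn2r ?nnegrE ?exprn_ge0//.
  by rewrite ler_wiXn2l// invf_le1// ler1n.
have zC m n : (n <= m)%N -> nsq (z m - z n) <= eps n.
  move=> nm; have hXm := L2B hX (hz m); have hXn := L2B hX (hz n).
  have := parallelogram hXn hXm.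
  rewrite [X in nsq X + _](_ : _ = cst 2%:C \* (X - cst (2^-1)%:C \* (z m + z n))); last first.
    apply/funext => w.
    rewrite -[LHS]/((X w - z n w) + (X w - z m w)).
    rewrite -[RHS]/(2%:C * (X w - (2^-1)%:C * (z m w + z n w))).
    by rewrite fmorphV rmorph_nat; field.
  have Lmid : L (cst (2^-1)%:C \* (z m + z n)) by apply: LZ; exact: LD.
  rewrite nsqZ; last by apply: L2B => //; exact: LL2.
  have -> : (X - z n) - (X - z m) = z m - z n.
    by rewrite opprB addrC addrA subrK.
  rewrite normc_sqr/= expr0n/= addr0.
  have := DL _ Lmid; have := Dz m; have := Dz n; have := eps_le m n nm.
  nra.
have [p hp pz] := L2_complete hz zC.
have Lp : L p.
  apply: clL; apply/L2closureP => //; split => // e e0.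
  have e2 : 0 < e / 2 by rewrite divr_gt0.
  have [n ne] := eps_small e2; exists (z n) => //.
  apply: (le_lt_trans (pz n)); lra.
exists p; split => // Z LZ0; have hZ := LL2 _ LZ0.
have q0 : 0 <= 1 + nsq Z by rewrite addr_ge0// nsq_ge0.
apply: (@sqr_normc_eq0 _ _ (5 * (1 + nsq Z))); first by rewrite mulr_ge0.
move=> e e0; have [n ne] := eps_small e0.
have hXz := L2B hX (hz n); have hzp := L2B (hz n) hp.
rewrite (_ : X - p = (X - z n) + (z n - p)); last by rewrite addrA subrK.
rewrite innerDl//; apply: (le_trans (normc_sqrD_le _ _)).
have zp := inner_sqr_le hzp hZ.
have Xz : normc (inner (X - z n) Z) ^+ 2 <= eps n / 4 * (1 + nsq Z).
  apply: almost_orthogonal => // a.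
  rewrite -addrA -opprD; have := DL _ (LD _ _ (Lz n) (LZ a _ LZ0)).
  have := Dz n; lra.
have pzn := pz n; rewrite nsqBC// in zp.
have : nsq (p - z n) * (1 + nsq Z) <= 2 * eps n * (1 + nsq Z) by rewrite ler_wpM2r.
have : eps n * (1 + nsq Z) <= e * (1 + nsq Z) by rewrite ler_wpM2r// ltW.
have : 0 <= e * (1 + nsq Z) by rewrite mulr_ge0// ltW.
nra.
Qed.

Lemma orth_projP L X : L2subspace P L -> L2closure L `<=` L -> L2 X ->
  is_orth_proj L X (orth_proj P L X).
Proof.
move=> sL clL hX; have [p hp] := is_orth_proj_exists sL clL hX.
exact: (xgetPex (P := is_orth_proj L X) 0 (ex_intro _ p hp)).
Qed.

(** The difference of two projections belongs to [L] and is orthogonal to [L],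
    hence to itself. *)
Lemma is_orth_proj_ae_unique L X p q : L2subspace P L -> L2 X ->
  is_orth_proj L X p -> is_orth_proj L X q -> p = q %[ae P].
Proof.
move=> sL hX [Lp op] [Lq oq].
have [LL2 _ _ _] := sL; have hp := LL2 _ Lp; have hq := LL2 _ Lq.
have Lpq := L2subspaceB sL Lp Lq; have hpq := LL2 _ Lpq.
have /(nsq_eq0P hpq) : nsq (p - q) = 0.
  apply: complexI; rewrite -inner_self.
  rewrite [X in inner X _](_ : _ = (X - q) - (X - p)); last first.
    by rewrite opprB [RHS]addrC addrA subrK.
  by rewrite innerBl ?op ?oq ?subr0//; exact: L2B.
by apply: filterS => w /[apply] pq; apply/eqP; rewrite -subr_eq0; exact/eqP.
Qed.

Lemma is_orth_proj_ae L X p q : L2subspace P L -> L2 X -> L q ->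
  is_orth_proj L X p -> p = q %[ae P] -> is_orth_proj L X q.
Proof.
move=> sL hX Lq [Lp op] pq; split => // Z LZ.
have [LL2 _ _ _] := sL; have hp := LL2 _ Lp; have hq := LL2 _ Lq.
have hZ := LL2 _ LZ; have hpq := L2B hp hq.
have -> : X - q = (X - p) + (p - q) by rewrite addrA subrK.
rewrite innerDl ?op ?add0r//; last exact: L2B.
apply: (inner_ae_eq0 hpq hZ).
by move: pq; apply: filterS => w /[apply] pqw; apply/eqP; rewrite subr_eq0; exact/eqP.
Qed.

Lemma closed_span_closed_subspace G : G `<=` L2 ->
  L2subspace P (closed_span P G) /\
  L2closure (closed_span P G) `<=` closed_span P G.
Proof.
move=> GL2; have sG := lin_span_subspace GL2; have [sL2 _ _ _] := sG.
by split; [exact: L2closure_subspace|exact: L2closure_closed].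
Qed.

Lemma sum_subspace L M : L2subspace P L -> L2subspace P M ->
  L2subspace P [set X + Y | X in L & Y in M].
Proof.
move=> [LL2 L0 LD LZ] [ML2 M0 MD MZ]; split.
- by move=> _ [X LX [Y MY <-]]; apply: L2D; [exact: LL2|exact: ML2].
- by exists 0 => //; exists 0 => //; rewrite addr0.
- move=> _ _ [X LX [Y MY <-]] [X' LX' [Y' MY' <-]].
  exists (X + X'); first exact: LD.
  by exists (Y + Y'); [exact: MD|rewrite addrACA].
- move=> a _ [X LX [Y MY <-]]; exists (cst a \* X); first exact: LZ.
  exists (cst a \* Y); first exact: MZ.
  by apply/funext => w; rewrite -[RHS]/(a * (X w + Y w)) mulrDr.
Qed.

(** The Hilbert space form of the theorem: conditional orthogonality of [M] and
    a closed span can be tested on the projections of the generators. *)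
Lemma cond_orthogonal_closed_span L M G :
  L2subspace P L -> L2closure L `<=` L -> L2subspace P M -> G `<=` L2 ->
  cond_orthogonal P M (closed_span P G) L <->
  forall Z, G Z -> orth_proj P (closed_join P L M) Z = orth_proj P L Z %[ae P].
Proof.
move=> sL clL sM GL2; have [LL2 L0 _ _] := sL; have [ML2 M0 _ _] := sM.
have sLM := sum_subspace sL sM; have [LML2 _ _ _] := sLM.
have sJ : L2subspace P (closed_join P L M) by exact: L2closure_subspace.
have clJ : L2closure (closed_join P L M) `<=` closed_join P L M.
  exact: L2closure_closed.
have LJ : L `<=` closed_join P L M.
  move=> X LX; apply: sub_L2closure => //.
  by exists X => //; exists 0 => //; rewrite addr0.
have MJ : M `<=` closed_join P L M.
  move=> X MX; apply: sub_L2closure => //.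
  by exists 0 => //; exists X => //; rewrite add0r.
have pL X : L2 X -> is_orth_proj L X (orth_proj P L X) by exact: orth_projP.
have GN : G `<=` closed_span P G.
  move=> Z GZ; apply: sub_L2closure; last exact: sub_lin_span.
  by have [] := lin_span_subspace GL2.
split=> [MNL Z GZ | projE X Z MX NZ].
  have hZ := GL2 _ GZ; have [Lp op] := pL _ hZ.
  have hp := LL2 _ Lp; have hZp := L2B hZ hp.
  (* The projection on L is also one on J, and projections on J agree. *)
  apply: (is_orth_proj_ae_unique sJ hZ); first exact: orth_projP.
  split; first exact: LJ.
  apply: orthogonal_L2closure => // _ [X1 LX1 [X2 MX2 <-]].
  have h1 := LL2 _ LX1; have h2 := ML2 _ MX2.
  have [Lq _] := pL _ h2; have hq := LL2 _ Lq.
  rewrite innerDr// op// add0r -(subrK (orth_proj P L X2) X2) innerDr//; last exact: L2B.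
  rewrite (op _ Lq) addr0 innerC//; last exact: L2B.
  by rewrite (MNL _ _ MX2 (GN _ GZ)) conjc0.
have hX := ML2 _ MX; have [Lq oq] := pL _ hX; have hq := LL2 _ Lq.
have hXq := L2B hX hq.
have hZ : L2 Z := L2closure_L2 NZ.
have [Lp _] := pL _ hZ; have hp := LL2 _ Lp.
(* Dropping the projection of Z leaves a condition linear and continuous in Z. *)
rewrite innerBr// (oq _ Lp) subr0.
apply: (orthogonal_L2closure hXq _ _ NZ).
  by have [] := lin_span_subspace GL2.
apply: orthogonal_lin_span => // {NZ hZ Lp hp}Z GZ.
have hZ := GL2 _ GZ; have [Lp op] := pL _ hZ; have hp := LL2 _ Lp.
have [_ oJ] := is_orth_proj_ae sJ hZ (LJ _ Lp) (orth_projP sJ clJ hZ) (projE _ GZ).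
rewrite -(subrK (orth_proj P L Z) Z) innerDr//; last exact: L2B.
rewrite (oq _ Lp) addr0 innerC//; last exact: L2B.
by rewrite (oJ _ (L2subspaceB sJ (MJ _ MX) (LJ _ Lq))) conjc0.
Qed.

End Projection.

(** * Contemporaneous uncorrelatedness *)

Theorem theorem4p5 (d : measure_display) (T : measurableType d) (R : realType)
    (P : probability T R) (k : nat) (Y : 'I_k -> R -> T -> R[i]%C)
    (Ystat : weakly_stationary P Y) (Yzero : zero_mean P Y)
    (Ycont : mean_square_continuous P Y)
    (A B S : {set 'I_k}) (AS : A \subset S) (BS : B \subset S)
    (AB : [disjoint A & B]) :
  contemporaneously_uncorrelated P Y A B S <->
  (forall (b : 'I_k) (h t : R), b \in B -> 0 <= h <= 1 ->
     orth_proj P (closed_join P (Lpast P Y S t) (Lspan P Y A t%:E (t + 1)%:E)) (Y b (t + h))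
     = orth_proj P (Lpast P Y S t) (Y b (t + h)) %[ae P]).
Proof.
have [YL2 _ _] := Ystat.
have genL2 (C : {set 'I_k}) (s t : \bar R) : ([set X | exists a (u : R),
    [/\ a \in C, (s <= u%:E <= t)%E & X = Y a u]] `<=` L2 P)%classic.
  by move=> _ [a [u [_ _ ->]]]; exact: YL2.
have orth_iff t := let: conj sL clL := closed_span_closed_subspace (genL2 S -oo%E t%:E) in
  let: conj sM _ := closed_span_closed_subspace (genL2 A t%:E (t + 1)%:E) in
  cond_orthogonal_closed_span sL clL sM (genL2 B t%:E (t + 1)%:E).
split=> [unc b h t bB /andP[h0 h1] | projE t].
  apply: ((orth_iff t).1 (unc t)); exists b, (t + h).
  by rewrite bB !lee_fin lerDl h0 lerD2l h1.
apply: (orth_iff t).2 => _ [b [u [bB /andP[tu ut] ->]]].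
rewrite !lee_fin in tu ut.
have := projE b (u - t) t bB; rewrite (addrC t (u - t)) subrK; apply.
by rewrite subr_ge0 tu lerBlDl.
Qed.
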